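(* If $\mathcal{C}$ is a minimal $[n,k]_{q^m/q}$ code with $k\ge2$, then $n\ge k+m-1$.
   Context: Let $q$ be a prime power and $n,m,k$ positive integers. For $v\in\mathbb{F}_{q^m}^n$ and an ordered basis $\Gamma=(\gamma_1,\dots,\gamma_m)$ of $\mathbb{F}_{q^m}$ over $\mathbb{F}_q$, let $\Gamma(v)\in\mathbb{F}_q^{n\times m}$ be the matrix with $v_i=\sum_{j}\Gamma(v)_{ij}\gamma_j$. The rank support $\sigma^{\mathrm{rk}}(v)\subseteq\mathbb{F}_q^n$ is the column space of $\Gamma(v)$ (independent of $\Gamma$). An $[n,k]_{q^m/q}$ code is a $k$-dimensional $\mathbb{F}_{q^m}$-subspace $\mathcal{C}\subseteq\mathbb{F}_{q^m}^n$. It is minimal if for all $v,v'\in\mathcal{C}$, $\sigma^{\mathrm{rk}}(v')\subseteq\sigma^{\mathrm{rk}}(v)$ implies $v'=\alpha v$ for some $\alpha\in\mathbb{F}_{q^m}$. *)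

(* Defs.v *)
From HB Require Import structures.
From mathcomp Require Import all_boot all_order all_algebra all_field.

Set Implicit Arguments.
Unset Strict Implicit.
Unset Printing Implicit Defensive.

Import GRing.Theory.
Local Open Scope ring_scope.

Section RankMetric.

(* F is the field with q elements (q := #|F|), and L is its extension of
   degree m := \dim {:L}. *)
Variables (F : finFieldType) (L : fieldExtType F) (n : nat).
Implicit Types (v : 'rV[L]_n) (C : {vspace 'rV[L]_n}).

Definition expand_mx m (Gamma : m.-tuple L) v : 'M[F]_(n, m) :=
  \matrix_(i, j) coord Gamma j (v 0 i).

Definition col_space m (A : 'M[F]_(n, m)) : {vspace 'cV[F]_n} :=
  <<[seq col j A | j : 'I_m]>>%VS.

(* The basis is fixed once and for all; rank_supportE shows that the choice
   does not matter. *)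
Definition rank_support v : {vspace 'cV[F]_n} :=
  col_space (expand_mx (vbasis {:L}) v).

Definition minimal_code C : Prop :=
  forall v v', v \in C -> v' \in C ->
  (rank_support v' <= rank_support v)%VS -> exists alpha : L, v' = alpha *: v.

Lemma expand_mxP m (Gamma : m.-tuple L) v i :
  basis_of {:L} Gamma -> v 0 i = \sum_j expand_mx Gamma v i j *: Gamma`_j.
Proof.
move=> bG; rewrite [LHS](coord_basis bG) ?memvf //.
by apply: eq_bigr => j _; rewrite mxE.
Qed.

Lemma col_space_sub m p (Gamma : m.-tuple L) (Delta : p.-tuple L) v :
  basis_of {:L} Gamma -> basis_of {:L} Delta ->
  (col_space (expand_mx Gamma v) <= col_space (expand_mx Delta v))%VS.
Proof.
move=> bG bD; apply/span_subvP => _ /mapP[j _ ->].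
suff -> : col j (expand_mx Gamma v) =
    \sum_(l < p) coord Gamma j Delta`_l *: col l (expand_mx Delta v).
  apply: memv_suml => l _; apply/memvZ/memv_span.
  by apply/mapP; exists l; rewrite ?mem_enum.
apply/colP=> i; rewrite summxE !mxE {1}(expand_mxP v i bD) linear_sum /=.
by apply: eq_bigr => l _; rewrite linearZ /= !mxE mulrC.
Qed.

Lemma rank_supportE m (Gamma : m.-tuple L) v :
  basis_of {:L} Gamma -> rank_support v = col_space (expand_mx Gamma v).
Proof.
move=> bG; have bL := vbasisP {:L}.
by apply: subv_anti; rewrite !col_space_sub.
Qed.

End RankMetric.

(* Main.v *)
(* A vector [v] gives an F-linear map [ev v : F^n -> L], [a |-> \sum_i a_i v_i],
   and [lker (ev v) <= lker (ev w)] forces the support of [w] into that of [v].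
   In a minimal code only the multiples of [v] vanish on [lker (ev v)], so
   [k <= 1 + \dim (lker (ev v)) = 1 + n - rk v] for every codeword [v].  It
   remains to find a codeword of rank [m].  If [v] has rank [r < m], minimality
   and [k >= 2] give a codeword [w] with [lker (ev v)] not inside [lker (ev w)],
   and double counting the pairs [(alpha, a)] with [alpha v(a) + w(a) = 0] shows
   that some [alpha v + w] has rank larger than [r]. *)
Require Import Defs.
From HB Require Import structures.
From mathcomp Require Import all_boot all_order all_algebra all_field.

Set Implicit Arguments.
Unset Strict Implicit.
Unset Printing Implicit Defensive.

Import GRing.Theory.
Local Open Scope ring_scope.

Lemma dim_lker_limg (K : fieldType) (vT wT : vectType K) (f : 'Hom(vT, wT)) :
  (\dim (lker f) + \dim (limg f))%N = dim vT.
Proof. by rewrite -[in LHS](capfv (lker f)) limg_ker_dim dimvf. Qed.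

(** Both summands are at most [q ^ (m + d - 1)], and [2 <= q]. This is the numerical contradiction
    that closes the double counting below. *)
Lemma expn_add_le q m d e r : (1 < q)%N -> (e < d)%N -> (r < m)%N ->
  (q ^ m * q ^ e + q ^ (d + r) <= q ^ m * q ^ d)%N.
Proof.
case: d m => [|d] [|m] // q_gt1; rewrite !ltnS => le_ed le_rm.
rewrite -!expnD [in leqRHS]addnS [in leqRHS]expnS.
apply: (@leq_trans (2 * q ^ (m.+1 + d))); last by rewrite leq_mul2r q_gt1 orbT.
rewrite mul2n -addnn leq_add // leq_exp2l ?leq_add2l //.
by rewrite !addSn ltnS addnC leq_add2r.
Qed.

Section LinearPencil.

Variables (F : finFieldType) (L : fieldExtType F).

Lemma exists_dim_limg_gt n (f g : 'Hom('rV[F]_n, L)) :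
    (\dim (limg f) < \dim {:L})%N -> ~~ (lker f <= lker g)%VS ->
  exists alpha : L,
    (\dim (limg f) < \dim (limg ((amull alpha \o f)%VF + g)%R))%N.
Proof.
set q := #|F|; set m := \dim {:L} => rf_lt nsub.
pose h alpha := ((amull alpha \o f)%VF + g)%R.
have hE alpha a : h alpha a = alpha * f a + g a.
  by rewrite add_lfunE comp_lfunE lfunE /=.
(* A copy of [L] with a finite type structure, so that one can sum over all [alpha]. *)
pose S := finvect_type L.
have cardS : #|S| = (q ^ m)%N.
  by rewrite -(@card_vspacef F S (Vector.class S)) card_vspace /m !dimvf.
have [/existsP[alpha alpha_gt]|none] :=
    boolP [exists alpha : S, (\dim (limg f) < \dim (limg (h alpha)))%N].
  by exists alpha.
have {none} ker_ge (alpha : S) : (\dim (lker f) <= \dim (lker (h alpha)))%N.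
  move/existsPn/(_ alpha): none; rewrite -leqNgt => le_h.
  have := dim_lker_limg f; rewrite -(dim_lker_limg (h alpha)) => /eqP E.
  by rewrite -(leq_add2r (\dim (limg f))) (eqP E) leq_add2l.
(* If [f a = 0], every [alpha] kills [a] or none does, according to [g a]; otherwise only
   [alpha = - g a / f a] does. The term for [lker f] stands on the left to avoid a truncated
   subtraction. *)
have pointwise (a : 'rV[F]_n) :
    (\sum_(alpha : S) (a \in lker (h alpha)) + (a \in lker f) <=
      q ^ m * (a \in (lker f :&: lker g)%VS) + 1)%N.
  rewrite memv_cap !memv_ker; have [fa0|fa0] /= := eqVneq (f a) 0.
    rewrite leq_add2r -cardS -sum1_card big_distrl /=.
    by apply: leq_sum => alpha _; rewrite memv_ker hE fa0 mulr0 add0r mul1n.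
  rewrite muln0 addn0 (bigD1 (- g a / f a : S)) //= big1 => [|alpha].
    by rewrite addn0 leq_b1.
  move=> /eqP ne; apply/eqP; rewrite eqb0; apply/negP.
  rewrite memv_ker hE addr_eq0 => /eqP eq_ag; apply: ne.
  by rewrite -eq_ag mulfK.
have card_sum (V : {vspace 'rV[F]_n}) : (\sum_(a : 'rV[F]_n) (a \in V) = q ^ \dim V)%N.
  rewrite -card_vspace -sum1_card [RHS]big_mkcond /=.
  by apply: eq_bigr => a _; case: (a \in V).
(* With d, e the dimensions of [lker f] and [lker f :&: lker g], summing over [a] and using [ker_ge]
   gives [q^m * q^d + q^d <= q^m * q^e + q^n], while [expn_add_le] bounds the right side by
   [q^m * q^d]. *)
have := leq_sum (index_enum 'rV[F]_n) (fun a (_ : true) => pointwise a).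
rewrite !big_split /= exchange_big /= card_sum -big_distrr /= card_sum.
rewrite sum1_card card_mx mul1n -/q.
have lb : (q ^ m * q ^ \dim (lker f) <=
    \sum_(alpha : S) \sum_(a : 'rV[F]_n) (a \in lker (h alpha)))%N.
  rewrite -cardS -sum_nat_const; apply: leq_sum => alpha _.
  by rewrite card_sum leq_exp2l ?finRing_gt1.
have q_gt1 : (1 < q)%N := finRing_gt1 F.
have cap_lt : (\dim (lker f :&: lker g)%VS < \dim (lker f))%N.
  rewrite ltn_neqAle dimvS ?capvSl // andbT; apply: contra nsub => /eqP E.
  by apply/capv_idPl/eqP; rewrite eqEdim capvSl E leqnn.
have dimE : (\dim (lker f) + \dim (limg f))%N = n.
  by rewrite dim_lker_limg dim_matrix mul1r.
have qd_gt0 : (0 < q ^ \dim (lker f))%N by rewrite expn_gt0 ltnW.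
have := expn_add_le q_gt1 cap_lt rf_lt; rewrite dimE => ub.
move/(leq_trans (leq_add lb (leqnn _))) => /leq_trans/(_ ub).
by rewrite leqNgt -[X in (X < _)%N]addn0 ltn_add2l qd_gt0.
Qed.

End LinearPencil.

Section Evaluation.

Variables (F : finFieldType) (L : fieldExtType F) (n : nat).
Implicit Types (v w : 'rV[L]_n) (a : 'rV[F]_n) (C : {vspace 'rV[L]_n}).

Definition pairing v a : L := \sum_i a 0 i *: v 0 i.

Fact pairing_is_linear v : linear (pairing v).
Proof.
move=> c a b; rewrite /pairing scaler_sumr -big_split /=.
by apply: eq_bigr => i _; rewrite !mxE scalerDl scalerA.
Qed.

HB.instance Definition _ v :=
  GRing.isLinear.Build F 'rV[F]_n L _ (pairing v) (pairing_is_linear v).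

Definition ev v : 'Hom('rV[F]_n, L) := linfun (pairing v).

Lemma evE v a : ev v a = \sum_i a 0 i *: v 0 i.
Proof. by rewrite lfunE. Qed.

Lemma ev_lin alpha v w : ev (alpha *: v + w) = (amull alpha \o ev v)%VF + ev w.
Proof.
apply/lfunP=> a; rewrite add_lfunE comp_lfunE !evE lfunE /= mulr_sumr -big_split.
by apply: eq_bigr => i _; rewrite !mxE scalerDr scalerAr.
Qed.

Lemma coord_ev v a j :
  coord (vbasis {:L}) j (ev v a) = (a *m expand_mx (vbasis {:L}) v) 0 j.
Proof.
rewrite evE linear_sum /= mxE; apply: eq_bigr => i _.
by rewrite linearZ /= mxE.
Qed.

Lemma ev_eq0 v a : (ev v a == 0) = (a *m expand_mx (vbasis {:L}) v == 0).
Proof.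
apply/eqP/eqP => [ev0|mx0].
  by apply/rowP=> j; rewrite -coord_ev ev0 linear0 mxE.
rewrite (coord_vbasis (memvf (ev v a))) big1 // => j _.
by rewrite coord_ev mx0 mxE scale0r.
Qed.

(** By [ev_eq0], [lker (ev v)] is the left kernel of the expansion matrix of [v], that is, the
    annihilator of its column space; annihilators reverse inclusions. *)
Lemma rank_support_sub v w :
  (lker (ev v) <= lker (ev w))%VS -> (rank_support w <= rank_support v)%VS.
Proof.
set A := expand_mx (vbasis {:L}) v; set B := expand_mx (vbasis {:L}) w.
move=> /subvP ker_sub; have /submxP[D defB] : (B^T <= A^T)%MS.
  (* The rows of the transposed cokernel of [A^T] lie in the left kernel of [A], hence in that of
     [B]. *)
  rewrite submxE -trmx_eq0 trmx_mul trmxK; apply/eqP/row_matrixP => i.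
  rewrite row_mul row0; apply/eqP; rewrite -ev_eq0 -memv_ker; apply: ker_sub.
  rewrite memv_ker ev_eq0 -row_mul -/A.
  by rewrite -[A in _ *m A]trmxK -trmx_mul mulmx_coker trmx0 row0.
apply/span_subvP => _ /mapP[j _ ->].
have -> : col j B = \sum_l D j l *: col l A.
  apply/colP=> i; rewrite summxE -[B]trmxK defB !mxE.
  by apply: eq_bigr => l _; rewrite !mxE.
apply: memv_suml => l _; apply/memvZ/memv_span.
by apply/mapP; exists l; rewrite ?mem_enum.
Qed.

Lemma minimal_exists_max_rank C :
  minimal_code C -> (2 <= \dim C)%N ->
  exists2 v, v \in C & \dim (limg (ev v)) = \dim {:L}.
Proof.
move=> minC dimC; suff large r : (r <= \dim {:L})%N ->
    exists2 v, v \in C & (r <= \dim (limg (ev v)))%N.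
  have [v vC ge_m] := large _ (leqnn _); exists v => //.
  by apply/eqP; rewrite eqn_leq ge_m dimvS ?subvf.
elim: r => [_|r IHr r_lt]; first by exists 0; rewrite ?mem0v.
have [v vC] := IHr (ltnW r_lt); rewrite leq_eqVlt => /predU1P[rE|]; last by exists v.
(* If no basis vector qualifies as [w], minimality puts all of [C] on the line of [v], against
   [2 <= \dim C]. *)
have [all_ker|/allPn[w /vbasis_mem wC nker]] :=
    boolP (all (fun w => lker (ev v) <= lker (ev w))%VS (vbasis C)).
  have : (C <= <[v]>)%VS.
    rewrite -(span_basis (vbasisP C)); apply/span_subvP => w w_in.
    apply/vlineP; apply: minC (vC) (vbasis_mem w_in) _.
    exact: rank_support_sub (allP all_ker w w_in).
  move/dimvS/(leq_trans dimC); rewrite dim_vline.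
  by case: (v != 0).
rewrite rE in r_lt *; have [alpha gt_alpha] := exists_dim_limg_gt r_lt nker.
by exists (alpha *: v + w); rewrite ?ev_lin // memvD ?memvZ.
Qed.

(* Vanishing on an F-basis of the kernel of a codeword [v] is a system of
   [\dim (lker (ev v))] linear equations over [L], whose only solutions in [C]
   are the multiples of [v]. *)
Lemma minimal_dim_le C v :
  minimal_code C -> v \in C -> (\dim C <= (\dim (lker (ev v))).+1)%N.
Proof.
move=> minC vC; set K := lker (ev v).
pose M : 'M[L]_(n, \dim K) := \matrix_(i, j) ((vbasis K)`_j 0 i)%:A.
pose phi : 'Hom('rV[L]_n, 'rV[L]_(\dim K)) := linfun (mulmxr M).
have phiE w j : phi w 0 j = ev w (vbasis K)`_j.
  rewrite lfunE /= mxE evE; apply: eq_bigr => i _.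
  by rewrite mxE -scalerAr mulr1.
(* Rank-nullity on [C]: the kernel lies in [<[v]>] and the image in a space of dimension
   [\dim K]. *)
rewrite -(limg_ker_dim phi C) -[(\dim K).+1]add1n; apply: leq_add.
  apply: (@leq_trans (\dim <[v]>)); last by rewrite dim_vline leq_b1.
  apply/dimvS/subvP => w /memv_capP[wC]; rewrite memv_ker => /eqP phi0.
  apply/vlineP; apply: minC => //; apply: rank_support_sub.
  rewrite -/K -(span_basis (vbasisP K)); apply/span_subvP => a a_in.
  have a_lt : (index a (vbasis K) < \dim K)%N by rewrite -index_mem size_tuple in a_in *.
  have := phiE w (Ordinal a_lt); rewrite phi0 mxE /= nth_index // => /esym ev0.
  by rewrite memv_ker ev0.
by rewrite (leq_trans (dimvS (subvf _))) // dimvf dim_matrix mul1r.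
Qed.

End Evaluation.

Theorem corollary5p10 (F : finFieldType) (L : fieldExtType F) (n m k : nat)
    (hm : \dim {:L} = m) (C : {vspace 'rV[L]_n}) (hC : \dim C = k)
    (hmin : minimal_code C) (hk : (2 <= k)%N) :
  (k + m - 1 <= n)%N.
Proof.
have [||v vC rk_v] := @minimal_exists_max_rank F L n C; rewrite ?hC //.
have := minimal_dim_le hmin vC; rewrite hC => k_le.
have := dim_lker_limg (ev v); rewrite rk_v hm dim_matrix mul1r => <-.
by rewrite leq_subLR add1n -addSn leq_add2r.
Qed.
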